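(* Let $A\in\mathbb{R}^{n\times n}$ be positive definite, $b\in\mathbb{R}^n$, and let $m$ be a nonnegative integer. For the vectors generated by SWI with window parameter $m$, for every $k$ and all integers $i\in[\max\{0,k-m\},\,k-1]$, it holds that $p_i^Tq_k=0$.
   Context: A real square (not necessarily symmetric) matrix $A$ is positive definite if $x^TAx>0$ for all nonzero $x\in\mathbb{R}^n$. SWI (sliding window implementation of the semi-conjugate gradient method), in exact arithmetic, with a nonnegative integer $m$. Set $x_0=0$, $r_0=b$, $p_0=r_0$, $q_0=Ap_0$. For $k=0,1,2,\dots$: compute $\alpha_k=r_k^Tp_k/(p_k^Tq_k)$, $x_{k+1}=x_k+\alpha_kp_k$, $r_{k+1}=r_k-\alpha_kq_k$; let $m_k=\min\{k,m\}$, form $v_{k+1}=Ar_{k+1}$, $P_{k+1}=[p_{k-m_k}\ \cdots\ p_k]$, $Q_{k+1}=[q_{k-m_k}\ \cdots\ q_k]$, $L_{k+1}=P_{k+1}^TQ_{k+1}$, solve $L_{k+1}\lambda_{k+1}=P_{k+1}^Tv_{k+1}$ and set $p_{k+1}=r_{k+1}-P_{k+1}\lambda_{k+1}$, $q_{k+1}=v_{k+1}-Q_{k+1}\lambda_{k+1}$. Iteration $k$ is well defined when $p_k^Tq_k\neq0$ and $L_{k+1}$ is nonsingular; quantities with index $k$ are ''generated'' if iterations $0,\dots,k-1$ are well defined. *)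

(* Defs.v *)
From HB Require Import structures.
From mathcomp Require Import all_boot all_order all_algebra.
From mathcomp Require Import reals.

Set Implicit Arguments.
Unset Strict Implicit.
Unset Printing Implicit Defensive.

Import Order.TTheory GRing.Theory Num.Theory.

Local Open Scope ring_scope.

Definition dotv (R : realType) (n : nat) (u v : 'cV[R]_n) : R :=
  (u^T *m v) 0 0.

(* No symmetry is required of [A]. *)
Definition posdef (R : realType) (n : nat) (A : 'M[R]_n) : Prop :=
  forall x : 'cV[R]_n, x != 0 -> 0 < (x^T *m A *m x) 0 0.

(* [swi_lambda s k] is lambda_(k+1), which has m_k + 1 entries, where
   m_k = min(k, m); the value [swi_v s 0] is not used by the algorithm. *)
Record swi_data (R : realType) (n m : nat) := SWIData {
  swi_x : nat -> 'cV[R]_n;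
  swi_r : nat -> 'cV[R]_n;
  swi_p : nat -> 'cV[R]_n;
  swi_q : nat -> 'cV[R]_n;
  swi_v : nat -> 'cV[R]_n;
  swi_alpha : nat -> R;
  swi_lambda : forall k : nat, 'cV[R]_((minn k m).+1)
}.

(* The matrix with columns u_(k - m_k), ..., u_k, where m_k = min(k, m);
   it carries the index k + 1 in P_(k+1) and Q_(k+1). *)
Definition window (R : realType) (n m : nat) (u : nat -> 'cV[R]_n) (k : nat) :
    'M[R]_(n, (minn k m).+1) :=
  \matrix_(i, j) u (k - minn k m + j)%N i 0.

(* L_(k+1) = P_(k+1)^T Q_(k+1) *)
Definition swi_L (R : realType) (n m : nat) (s : swi_data R n m) (k : nat) :
    'M[R]_((minn k m).+1) :=
  (window m (swi_p s) k)^T *m window m (swi_q s) k.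

Definition swi_init (R : realType) (n m : nat) (A : 'M[R]_n) (b : 'cV[R]_n)
    (s : swi_data R n m) : Prop :=
  [/\ swi_x s 0%N = 0,
      swi_r s 0%N = b,
      swi_p s 0%N = swi_r s 0%N
    & swi_q s 0%N = A *m swi_p s 0%N].

Definition swi_well_defined (R : realType) (n m : nat) (s : swi_data R n m)
    (k : nat) : Prop :=
  dotv (swi_p s k) (swi_q s k) != 0 /\ swi_L s k \in unitmx.

Definition swi_step (R : realType) (n m : nat) (A : 'M[R]_n)
    (s : swi_data R n m) (k : nat) : Prop :=
  let P := window m (swi_p s) k in
  let Q := window m (swi_q s) k in
  [/\ swi_alpha s k
        = dotv (swi_r s k) (swi_p s k) / dotv (swi_p s k) (swi_q s k),
      swi_x s k.+1 = swi_x s k + swi_alpha s k *: swi_p s k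
    & swi_r s k.+1 = swi_r s k - swi_alpha s k *: swi_q s k] /\
  [/\ swi_v s k.+1 = A *m swi_r s k.+1,
      swi_L s k *m swi_lambda s k = P^T *m swi_v s k.+1,
      swi_p s k.+1 = swi_r s k.+1 - P *m swi_lambda s k
    & swi_q s k.+1 = swi_v s k.+1 - Q *m swi_lambda s k].

(* The quantities of index at most K in [s] are those generated by SWI:
   iterations 0, ..., K - 1 are well defined and carried out.  The entries
   of [s] beyond that are arbitrary. *)
Definition swi_generated (R : realType) (n m : nat) (A : 'M[R]_n)
    (b : 'cV[R]_n) (s : swi_data R n m) (K : nat) : Prop :=
  swi_init A b s /\
  forall k : nat, (k < K)%N -> swi_well_defined s k /\ swi_step A s k.

(* Main.v *)
Require Import Defs.
From HB Require Import structures.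
From mathcomp Require Import all_boot all_order all_algebra.
From mathcomp Require Import reals.
From mathcomp Require Import zify.

Set Implicit Arguments.
Unset Strict Implicit.
Unset Printing Implicit Defensive.

Import Order.TTheory GRing.Theory Num.Theory.

Local Open Scope ring_scope.

(** The vector [lambda] is chosen so that [q_(k+1) = v - Q lambda] is orthogonal to every column of
    [P], since [P^T Q = L] ([window_swi_q]). These columns include every [p_i] of the claim, and
    [window_dotv] reads off one column. *)

Lemma window_dotv (R : realType) (n m : nat) (u : nat -> 'cV[R]_n)
    (k i : nat) (w : 'cV[R]_n) :
  (k - m <= i <= k)%N -> (window m u k)^T *m w = 0 -> dotv (u i) w = 0.
Proof.
move=> /andP[lo_i le_ik] Pw0.
(* Truncated subtraction gives [k - m = k - minn k m], the index of the first column, so [u i] is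
   the column at this offset. *)
have off_lt : (i - (k - minn k m) < (minn k m).+1)%N by lia.
have off_i : (k - minn k m + (i - (k - minn k m)))%N = i by lia.
have /matrixP /(_ (Ordinal off_lt) 0) := Pw0.
rewrite !mxE => entry0; rewrite /dotv mxE -[RHS]entry0.
by apply: eq_bigr => l _; rewrite !mxE /= off_i.
Qed.

(* The defining equation [L lambda = P^T v] of lambda says exactly that
   [P^T (v - Q lambda) = 0]. *)
Lemma window_swi_q (R : realType) (n m : nat) (A : 'M[R]_n)
    (s : swi_data R n m) (k : nat) :
  swi_step A s k -> (window m (swi_p s) k)^T *m swi_q s k.+1 = 0.
Proof. by move=> [_ [_ Llam _ ->]]; rewrite mulmxBr mulmxA -Llam subrr. Qed.

Theorem corollary3p1 (R : realType) (n m : nat) (A : 'M[R]_n) (b : 'cV[R]_n)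
    (s : swi_data R n m) (k : nat) :
  posdef A ->
  swi_generated A b s k ->
  forall i : nat, (maxn 0 (k - m) <= i < k)%N ->
    dotv (swi_p s i) (swi_q s k) = 0.
Proof.
move=> _ [_ gen] i; case: k gen => [|k] gen lo_hi_i; first by lia.
have [_ stepk] := gen k (ltnSn k).
(* The index is now [k.+1], and [k.+1 - m <= i] implies [k - m <= i], so [p_i] lies in the window
   ending at [k]. *)
by apply: window_dotv (window_swi_q stepk); lia.
Qed.
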